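(* Let $n\ge1$ and let $A$ be a $2n\times 2n$ real symmetric positive definite matrix, written in block form $A=\begin{pmatrix} A_{11} & A_{12}\\ A_{12}^T & A_{22}\end{pmatrix}$ with $n\times n$ blocks. Let $\Delta_{11},\Delta_{12},\Delta_{22}\in\mathbb{R}^n$ be the vectors of diagonal entries of $A_{11},A_{12},A_{22}$ respectively, and define (all operations entrywise) $$\Delta_{\mathrm{w}}(A)\coloneqq\sqrt{\frac{\Delta_{11}^2+\Delta_{22}^2}{2}},\qquad \Delta_{\mathrm{h}}(A)\coloneqq\sqrt{\frac{\Delta_{11}^2+\Delta_{22}^2+2\Delta_{12}^2}{2}}.$$ Then the following are equivalent: (i) $\Delta_{\mathrm{w}}(A)\prec d_{\mathrm{s}}(A)$; (ii) $\Delta_{\mathrm{h}}(A)\prec d_{\mathrm{s}}(A)$; (iii) $A$ is orthosymplectically diagonalizable in the sense of Williamson's theorem.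
   Context: Let $J_{2n}=\begin{pmatrix}0 & I_n\\ -I_n & 0\end{pmatrix}$. A $2n\times 2n$ real matrix $S$ is symplectic if $S^TJ_{2n}S=J_{2n}$; $S$ is orthosymplectic if it is symplectic and orthogonal ($S^TS=I_{2n}$). Williamson's theorem: for every $2n\times 2n$ real symmetric positive definite matrix $B$ there is a symplectic $S$ with $S^TBS=\begin{pmatrix} D&0\\0&D\end{pmatrix}$, where $D$ is an $n\times n$ diagonal matrix with positive diagonal entries; these diagonal entries, which are uniquely determined up to order, are the symplectic eigenvalues of $B$, and $d_{\mathrm{s}}(B)\in\mathbb{R}^n$ denotes the vector of symplectic eigenvalues $d_1(B)\le\cdots\le d_n(B)$. $B$ is called orthosymplectically diagonalizable in the sense of Williamson's theorem if such an $S$ can be chosen orthosymplectic. For $x\in\mathbb{R}^n$ write $x^\uparrow_1\le\cdots\le x^\uparrow_n$ for its entries in increasing order. For $x,y\in\mathbb{R}^n$, $x$ is majorized by $y$, written $x\prec y$, if $\sum_{i=1}^k x^\uparrow_i\ge\sum_{i=1}^k y^\uparrow_i$ for $k=1,\dots,n$, with equality for $k=n$. *)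

(* Defs.v *)
From HB Require Import structures.
From mathcomp Require Import all_boot all_order all_algebra.
From mathcomp Require Import boolp classical_sets.
Set Implicit Arguments. Unset Strict Implicit. Unset Printing Implicit Defensive.
Import Order.TTheory GRing.Theory Num.Theory.
Local Open Scope ring_scope.

Section Defs.
Variable R : rcfType.

Definition Jmx (n : nat) : 'M[R]_(n + n) :=
  block_mx 0 1%:M (- 1%:M) 0.

Definition symplectic (n : nat) (S : 'M[R]_(n + n)) : Prop :=
  S^T *m Jmx n *m S = Jmx n.

Definition orthogonal_mx (n : nat) (S : 'M[R]_(n + n)) : Prop :=
  S^T *m S = 1%:M.

Definition orthosymplectic (n : nat) (S : 'M[R]_(n + n)) : Prop :=
  symplectic S /\ orthogonal_mx S.

Definition symmetric_mx (m : nat) (A : 'M[R]_m) : Prop := A^T = A.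

Definition posdef_mx (m : nat) (A : 'M[R]_m) : Prop :=
  symmetric_mx A /\ forall v : 'rV[R]_m, v != 0 -> 0 < (v *m A *m v^T) 0 0.

Definition dbldiag (n : nat) (d : 'rV[R]_n) : 'M[R]_(n + n) :=
  block_mx (diag_mx d) 0 0 (diag_mx d).

Definition williamson_diag (n : nat) (B : 'M[R]_(n + n)) (d : 'rV[R]_n) : Prop :=
  (forall i, 0 < d 0 i) /\ exists S : 'M[R]_(n + n), symplectic S /\ S^T *m B *m S = dbldiag d.

Definition is_sympl_eigs (n : nat) (B : 'M[R]_(n + n)) (d : 'rV[R]_n) : Prop :=
  williamson_diag B d /\ (forall i j : 'I_n, (i <= j)%N -> d 0 i <= d 0 j).

(* d_s(B), chosen (it is unique by Williamson's theorem) *)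
Definition sympl_eigs (n : nat) (B : 'M[R]_(n + n)) : 'rV[R]_n :=
  xget 0 (is_sympl_eigs B).

Definition orthosympl_diagonalizable (n : nat) (B : 'M[R]_(n + n)) : Prop :=
  exists d : 'rV[R]_n, (forall i, 0 < d 0 i) /\
    exists S : 'M[R]_(n + n), orthosymplectic S /\ S^T *m B *m S = dbldiag d.

Definition incr_entries (n : nat) (x : 'rV[R]_n) : seq R :=
  sort <=%R [seq x 0 i | i <- enum 'I_n].

Definition majorized (n : nat) (x y : 'rV[R]_n) : Prop :=
  (forall k : nat, (1 <= k <= n)%N ->
     \sum_(i < k) (incr_entries y)`_i <= \sum_(i < k) (incr_entries x)`_i) /\
  \sum_(i < n) (incr_entries x)`_i = \sum_(i < n) (incr_entries y)`_i.

Definition Delta_w (n : nat) (A : 'M[R]_(n + n)) : 'rV[R]_n :=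
  \row_i Num.sqrt (((ulsubmx A) i i ^+ 2 + (drsubmx A) i i ^+ 2) / 2).

Definition Delta_h (n : nat) (A : 'M[R]_(n + n)) : 'rV[R]_n :=
  \row_i Num.sqrt (((ulsubmx A) i i ^+ 2 + (drsubmx A) i i ^+ 2
                    + 2 * (ursubmx A) i i ^+ 2) / 2).

End Defs.

(* Main.v *)
(* Let [D = d_s(A)] and [S] symplectic with [S^T A S = D (+) D]; put [T = S^-1].
   The rows of [T] form a symplectic basis [(u_i, v_i)], so that
   [tr A = sum_i D_i (|u_i|^2 + |v_i|^2) >= 2 sum_i D_i], because
   [|u|^2 + |v|^2 >= 2 u J v^T].  Equality forces [T J = J T], and a symplectic
   matrix commuting with [J] is orthogonal.  Since [Delta_w] and [Delta_h]
   dominate [(Delta_11 + Delta_22) / 2], either majorization, through the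
   equality of the sums alone, gives [tr A <= 2 sum_i D_i] and hence an
   orthosymplectic [S].  Conversely, an orthosymplectic [S] has blocks
   [X, Y, -Y, X] with [X + i Y] unitary, whence [Delta_12 = 0] and
   [Delta_11 = Delta_22] is the image of [D] under the doubly stochastic matrix
   [(X_ij^2 + Y_ij^2)]; so [Delta_w = Delta_h] is majorized by [D].
   Williamson's theorem itself is obtained from [K = J A^-1], which is
   skew-adjoint for the inner product of [A]: complex eigenvectors of [K] yield
   mutually [A]-orthogonal [K]-stable planes. *)
Require Import Defs.
From HB Require Import structures.
From mathcomp Require Import all_boot all_order all_fingroup all_algebra.
From mathcomp Require Import complex ring lra.
Set Implicit Arguments. Unset Strict Implicit. Unset Printing Implicit Defensive.
Import Order.TTheory GRing.Theory Num.Theory.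
Local Open Scope ring_scope.

(** * Invariant planes of skew-adjoint maps *)

(** Over the algebraically closed [R[i]], [Q] has an eigenvector [p + i q] with eigenvalue
    [a + i b]; the two equations are the real and imaginary parts of the eigenvector equation. *)
Lemma real_eigenpair (R : rcfType) (r : nat) (Q : 'M[R]_r) : (0 < r)%N ->
  exists a b (p q : 'rV[R]_r), [/\ (p != 0) || (q != 0),
    p *m Q = a *: p - b *: q & q *m Q = b *: p + a *: q].
Proof.
move=> r0.
have [[a b] /eigenvalueP[v vE v0]] :=
  @eigenvalue_closed R[i]%C _ (map_mx (real_complex R) Q) r0.
pose p := \row_i complex.Re (v 0 i) : 'rV[R]_r.
pose q := \row_i complex.Im (v 0 i) : 'rV[R]_r.
have sumC (F : 'I_r -> R[i]%C) : \sum_i F i =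
    Complex (\sum_i complex.Re (F i)) (\sum_i complex.Im (F i)).
  by elim/big_rec3: _ => // i x y z _ ->; case: (F i).
have vQ i : Complex ((p *m Q) 0 i) ((q *m Q) 0 i) =
    Complex (a * p 0 i - b * q 0 i) (a * q 0 i + b * p 0 i).
  move/rowP: vE => /(_ i); rewrite !mxE sumC.
  case: (v 0 i) => vr vi vE.
  have [<- <-] : _ = Complex (a * vr - b * vi) (a * vi + b * vr) := vE.
  congr Complex; apply: eq_bigr => j _;
    rewrite !mxE; case: (v 0 j) => ? ? /=; ring.
exists a, b, p, q; split.
- apply: contraNT v0; rewrite negb_or !negbK => /andP[/eqP/rowP p0 /eqP/rowP q0].
  apply/eqP/rowP => i; move: (p0 i) (q0 i); rewrite !mxE.
  by case: (v 0 i) => /= ? ? -> ->.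
- by apply/rowP => i; case: (vQ i) => -> _; rewrite !mxE.
- by apply/rowP => i; case: (vQ i) => _ ->; rewrite !mxE addrC.
Qed.

(** The eigenpair is found for the matrix of [K] restricted to [W] in the basis [row_base W], then
    carried back; freeness of that basis keeps it nonzero. *)
Lemma stable_eigenpair (R : rcfType) (k m : nat) (W : 'M[R]_(k, m)) (K : 'M[R]_m) :
    W != 0 -> (W *m K <= W)%MS ->
  exists a b (x y : 'rV[R]_m), [/\ (x <= W)%MS, (y <= W)%MS,
    (x != 0) || (y != 0), x *m K = a *: x - b *: y & y *m K = b *: x + a *: y].
Proof.
move=> W0 WK; pose B := row_base W.
have /submxP[Q BQ] : (B *m K <= B)%MS.
  by rewrite (submx_trans (submxMr K _) (submx_trans WK _)) ?eq_row_base.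
have [|a [b [p [q [pq pQ qQ]]]]] := @real_eigenpair R (\rank W) Q.
  by rewrite lt0n mxrank_eq0.
have pB0 (u : 'rV_(\rank W)) : (u *m B == 0) = (u == 0).
  by rewrite mulmx_free_eq0 ?row_base_free.
exists a, b, (p *m B), (q *m B); split; rewrite ?pB0 //.
- by rewrite (submx_trans (submxMl _ _)) ?eq_row_base.
- by rewrite (submx_trans (submxMl _ _)) ?eq_row_base.
- by rewrite -mulmxA BQ mulmxA pQ mulmxBl -!scalemxAl.
- by rewrite -mulmxA BQ mulmxA qQ mulmxDl -!scalemxAl.
Qed.

Definition bform {R : pzRingType} {m : nat} (M : 'M[R]_m) (x y : 'rV[R]_m) : R :=
  (x *m M *m y^T) 0 0.

Section Bilinear.
Variables (R : comPzRingType) (m : nat) (M : 'M[R]_m).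
Implicit Types (x y z : 'rV[R]_m) (a : R).

Lemma bformDl x y z : bform M (x + y) z = bform M x z + bform M y z.
Proof. by rewrite /bform !mulmxDl mxE. Qed.

Lemma bformZl a x y : bform M (a *: x) y = a * bform M x y.
Proof. by rewrite /bform -!scalemxAl mxE. Qed.

Lemma bformZr a x y : bform M x (a *: y) = a * bform M x y.
Proof. by rewrite /bform linearZ /= -scalemxAr mxE. Qed.

Lemma bform_tr x y : bform M^T x y = bform M y x.
Proof.
have -> : bform M y x = (y *m M *m x^T)^T 0 0 by rewrite [RHS]mxE.
by rewrite !trmx_mul trmxK mulmxA.
Qed.

Lemma bformMl (K : 'M[R]_m) x y : bform M (x *m K) y = bform (K *m M) x y.
Proof. by rewrite /bform mulmxA. Qed.

Lemma bform_sym x y : M^T = M -> bform M x y = bform M y x.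
Proof. by move=> sM; rewrite -bform_tr sM. Qed.
End Bilinear.

Lemma bform_skew (R : comPzRingType) (m : nat) (M K : 'M[R]_m) (x y : 'rV[R]_m) :
  (K *m M)^T = - (K *m M) -> bform M (x *m K) y = - bform M (y *m K) x.
Proof.
move=> skK; rewrite !bformMl -[LHS]bform_tr skK /bform mulmxN mulNmx.
by rewrite [LHS]mxE.
Qed.

(** Skew-adjointness makes the eigenvalue purely imaginary and [x], [y] orthogonal of equal
    [A]-length. Rescaling makes the squared length the inverse of the rotation rate, so one number
    [d] plays both roles. *)
Lemma skew_plane (R : rcfType) (k m : nat) (A K : 'M[R]_m) (W : 'M[R]_(k, m)) :
    posdef_mx A -> K \in unitmx -> (K *m A)^T = - (K *m A) ->
    W != 0 -> (W *m K <= W)%MS ->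
  exists d (x y : 'rV[R]_m),
    [/\ (x <= W)%MS, (y <= W)%MS, 0 < d & x *m K = d^-1 *: y /\ y *m K = - d^-1 *: x] /\
    [/\ bform A x x = d, bform A y y = d & bform A x y = 0].
Proof.
move=> [sA pA] uK skK W0 WK.
have [a [b [x [y [xW yW xy0 xK yK]]]]] := stable_eigenpair W0 WK.
have bA u v := bform_sym u v sA; have bK u v := bform_skew u v skK.
have ge0 u : 0 <= bform A u u.
  have [->|u0] := eqVneq u 0; last exact/ltW/pA.
  by rewrite /bform !mul0mx mxE.
have gt0 u : u != 0 -> 0 < bform A u u by move=> /pA.
have kxx := bK x x; have kyy := bK y y; have kxy := bK x y.
move: kxx kyy kxy.
rewrite !xK !yK -!scaleNr !bformDl !bformZl (bA y x) => kxx kyy kxy.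
have S0 : 0 < bform A x x + bform A y y.
  by move: (ge0 x) (ge0 y); case/orP: xy0 => /gt0; lra.
(* Adding [kxx] and [kyy] cancels the cross terms and leaves [a] times the sum that [S0] shows
   positive. *)
have a0 : a = 0.
  apply: (mulIf (lt0r_neq0 S0)); rewrite mul0r; lra.
have b0 : b != 0.
  apply: contraTN xy0 => /eqP b0; move: xK yK.
  rewrite a0 b0 !scale0r subr0 addr0 => xK yK.
  have kern (u : 'rV_m) : u *m K = 0 -> u = 0.
    by move=> uK0; rewrite -[u](mulmxK uK) uK0 mul0mx.
  by rewrite (kern _ xK) (kern _ yK) eqxx.
rewrite a0 in xK yK kxx kyy kxy.
have oxy : bform A x y = 0.
  apply: (mulfI b0); rewrite mulr0; lra.
have exy : bform A x x = bform A y y by apply: (mulfI b0); lra.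
have cpos : 0 < bform A x x by move: S0; rewrite exy; lra.
rewrite !scale0r add0r addr0 in xK yK.
(* [main] treats a positive rate [e]; the sign of [b] then decides which of [x], [y] comes first. *)
have main e (u v : 'rV_m) : (u <= W)%MS -> (v <= W)%MS -> 0 < e ->
    u *m K = e *: v -> v *m K = - e *: u -> bform A u u = bform A v v ->
    bform A u v = 0 -> 0 < bform A u u ->
  exists d (x y : 'rV[R]_m),
    [/\ (x <= W)%MS, (y <= W)%MS, 0 < d & x *m K = d^-1 *: y /\ y *m K = - d^-1 *: x] /\
    [/\ bform A x x = d, bform A y y = d & bform A x y = 0].
  move=> uW vW e0 uKv vKu euv ouv u0.
  pose s := Num.sqrt (e * bform A u u)^-1.
  have s2 : s * s * bform A u u = e^-1.
    rewrite -expr2 sqr_sqrtr; last by rewrite invr_ge0 ltW ?mulr_gt0.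
    by rewrite invfM -mulrA mulVf ?mulr1 // lt0r_neq0.
  exists e^-1, (s *: u), (s *: v); split; last first.
    by split; rewrite bformZl bformZr mulrA ?ouv ?mulr0 // -?euv.
  split; rewrite ?scalemx_sub ?invr_gt0 //; split; rewrite invrK -scalemxAl.
    by rewrite uKv !scalerA mulrC.
  by rewrite vKu !scalerA mulrC.
have [bp|bN] := ltP 0 b.
  by apply: (main b y x) => //; rewrite ?xK ?scaleNr // -?exy // bA.
apply: (main (- b) x y) => //; rewrite ?xK ?yK ?opprK ?scaleNr //.
by rewrite oppr_gt0 lt_def eq_sym b0.
Qed.

(** Induction on the number of planes: the [A]-orthogonal complement of those already found is
    [K]-stable by skew-adjointness and nonzero by dimension, so it contains one more. *)
Lemma skew_planes (R : rcfType) (m : nat) (A K : 'M[R]_m) (k : nat) :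
    posdef_mx A -> K \in unitmx -> (K *m A)^T = - (K *m A) -> (k + k <= m)%N ->
  exists (d : nat -> R) (u v : nat -> 'rV[R]_m),
    (forall i, (i < k)%N ->
      [/\ 0 < d i, u i *m K = (d i)^-1 *: v i & v i *m K = - (d i)^-1 *: u i]) /\
    (forall i j, (i < k)%N -> (j < k)%N ->
      [/\ bform A (u i) (u j) = d i *+ (i == j),
          bform A (v i) (v j) = d i *+ (i == j) & bform A (u i) (v j) = 0]).
Proof.
move=> pA uK skK; elim: k => [|k IHk] km; first by exists (fun=> 1), (fun=> 0), (fun=> 0).
have {IHk}[|d [u [v [uvK uvA]]]] := IHk.
  by apply: leq_trans km; rewrite leq_add.
have sA : A^T = A by case: pA.
have bA x y := bform_sym x y sA; have bK x y := bform_skew x y skK.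
pose T := col_mx (\matrix_(i < k) u i) (\matrix_(i < k) v i).
(* The rows of [W] span the vectors [A]-orthogonal to every [u i] and [v i], as [inW] makes
   explicit. *)
pose W := kermx (A *m T^T).
have colM (p q : nat) (M : 'M[R]_(p, m)) (f : nat -> 'rV_m) (i : 'I_p) (j : 'I_q) :
    (M *m A *m (\matrix_(i < q) f i)^T) i j = bform A (row i M) (f j).
  by rewrite /bform -!row_mul !mxE; apply: eq_bigr => l _; rewrite !mxE.
have inW w : (w <= W)%MS <->
    forall i, (i < k)%N -> bform A w (u i) = 0 /\ bform A w (v i) = 0.
  split=> [/sub_kermxP | wT].
    rewrite mulmxA tr_col_mx mul_mx_row -(@row_mx0 _ 1 k k).
    case/eq_row_mx => wu wv i ik; rewrite -{1}[w](row_id 0) -{2}[w](row_id 0).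
    by rewrite -!(colM _ _ _ _ _ (Ordinal ik)) wu wv !mxE.
  apply/sub_kermxP; rewrite mulmxA tr_col_mx mul_mx_row.
  rewrite -(@row_mx0 _ 1 k k); congr row_mx;
    apply/matrixP => i j; rewrite colM row_id mxE; by case: (wT j (ltn_ord j)).
have W0 : W != 0.
  rewrite -mxrank_eq0 mxrank_ker subn_eq0 -ltnNge.
  have kkm : (k + k < m)%N by apply: leq_trans km; rewrite addnS ltnS addSn.
  apply: leq_ltn_trans kkm; exact: rank_leq_col.
have WK : (W *m K <= W)%MS.
  apply/row_subP => i; rewrite row_mul; apply/inW => j jk.
  have /inW/(_ j jk)[wu wv] : (row i W <= W)%MS by exact: row_sub.
  have [_ uK' vK] := uvK _ jk.
  by rewrite !(bK (row i W)) uK' vK !bformZl ![bform A _ (row i W)]bA wu wv !mulr0 oppr0.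
have [e [x [y [[xW yW e0 [xK yK]] [xx yy xy]]]]] := skew_plane pA uK skK W0 WK.
pose upd (T : Type) (f : nat -> T) z i := if i == k then z else f i.
exists (upd _ d e), (upd _ u x), (upd _ v y); rewrite /upd; split=> [i|i j].
  by rewrite ltnS leq_eqVlt; case: eqP => //= _; exact: uvK.
have /inW Wx := xW; have /inW Wy := yW.
rewrite !ltnS [(i <= k)%N]leq_eqVlt [(j <= k)%N]leq_eqVlt.
have [->|ik] := eqVneq i k; have [->|jk] := eqVneq j k => //= ik' jk'.
- by have [-> _] := Wx _ jk'; have [_ ->] := Wy _ jk'; have [_ ->] := Wx _ jk'.
- have [xu xv] := Wx _ ik'; have [yu yv] := Wy _ ik'.
  rewrite ![bform A _ x]bA ![bform A _ y]bA.
  by rewrite xu yv yu (negPf ik).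
- exact: uvA.
Qed.

(** * Existence of the Williamson normal form with ordered eigenvalues *)

Section Symplectic.
Variable R : rcfType.

Lemma Jmx_tr n : (Jmx R n)^T = - Jmx R n.
Proof.
by rewrite /Jmx tr_block_mx opp_block_mx !trmx0 oppr0 opprK linearN /= trmx1.
Qed.

Lemma JmxM n : Jmx R n *m Jmx R n = - 1%:M.
Proof.
rewrite /Jmx mulmx_block !(mul0mx, mulmx0, mulmx1, mul1mx, addr0, add0r).
by rewrite (scalar_mx_block n n 1) opp_block_mx !oppr0.
Qed.
End Symplectic.

Lemma incr_entries_perm (R : rcfType) (n : nat) (x : 'rV[R]_n) :
  exists s : 'S_n, forall i : 'I_n, (incr_entries x)`_i = x 0 (s i).
Proof.
pose t := [tuple x 0 i | i < n].
have sz : size (incr_entries x) == n by rewrite size_sort size_map size_enum_ord.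
have : perm_eq (Tuple sz) t by rewrite perm_sort.
case/tuple_permP => s E; exists s => i.
have -> : incr_entries x = Tuple sz by [].
by rewrite E -tnth_nth !tnth_mktuple.
Qed.

Lemma incr_entries_sorted (R : rcfType) (n : nat) (x : 'rV[R]_n) (i j : 'I_n) :
  (i <= j)%N -> (incr_entries x)`_i <= (incr_entries x)`_j.
Proof.
move=> ij; have sz : size (incr_entries x) = n by rewrite size_sort size_map size_enum_ord.
have so : sorted <=%R (incr_entries x) by apply: sort_sorted; exact: le_total.
by apply: (sorted_leq_nth le_trans lexx) => //; rewrite inE sz.
Qed.

(** Since [K *m A] is [Jmx R n], the symplectic form is [bform A (x *m K) y]. The rate [(d i)^-1] of
    [K] cancels the squared length [d i], so a single basis is both symplectic and diagonalizing for
    [A]. *)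
Lemma williamson_exists (R : rcfType) (n : nat) (A : 'M[R]_(n + n)) :
  posdef_mx A -> exists d, williamson_diag A d.
Proof.
move=> pA; have uA : A \in unitmx.
  rewrite -row_free_unit -kermx_eq0; apply/negPn/negP => /rowV0Pn[v /sub_kermxP vA v0].
  by case: pA => _ /(_ v v0); rewrite vA mul0mx mxE ltxx.
have uJ : Jmx R n \in unitmx.
  by apply: (@mulmx1_unit _ _ _ (- Jmx R n) _).1; rewrite mulmxN JmxM opprK.
pose K := Jmx R n *m invmx A.
have KA : K *m A = Jmx R n by rewrite mulmxKV.
have [||d [u [v [uvK uvA]]]] := skew_planes pA (_ : K \in unitmx) (_ : _ = _) (leqnn (n + n)).
- by rewrite unitmx_mul uJ unitmx_inv.
- by rewrite KA Jmx_tr.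
exists (\row_i d i); split=> [i|]; first by rewrite mxE; case: (uvK i (ltn_ord i)).
pose U := \matrix_(i < n) u i; pose V := \matrix_(i < n) v i.
have entry (M : 'M[R]_(n + n)) (f g : nat -> 'rV_(n + n)) (i j : 'I_n) :
    (\matrix_(i < n) f i *m M *m (\matrix_(i < n) g i)^T) i j = bform M (f i) (g j).
  by rewrite /bform -[in RHS](rowK (fun i : 'I_n => f i)) -!row_mul !mxE;
     apply: eq_bigr => l _; rewrite !mxE.
have bA x y : bform A x y = bform A y x by apply: bform_sym; case: pA.
have bJ x y : bform (Jmx R n) x y = bform A (x *m K) y by rewrite bformMl KA.
exists (col_mx U V)^T; rewrite /symplectic trmxK tr_col_mx.
rewrite !(mul_col_mx U V) !mul_col_row.
split; congr block_mx; apply/matrixP => i j; rewrite entry.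
- have [_ uK _] := uvK i (ltn_ord i); have [_ _ uv] := uvA j i (ltn_ord j) (ltn_ord i).
  by rewrite bJ uK bformZl bA uv mulr0 mxE.
- have [d0 uK _] := uvK i (ltn_ord i); have [_ vv _] := uvA i j (ltn_ord i) (ltn_ord j).
  by rewrite bJ uK bformZl vv mxE mulrnAr mulVf // gt_eqF.
- have [d0 _ vK] := uvK i (ltn_ord i); have [uu _ _] := uvA i j (ltn_ord i) (ltn_ord j).
  by rewrite bJ vK bformZl uu !mxE mulrnAr mulNr mulVf ?mulNrn // gt_eqF.
- have [_ _ vK] := uvK i (ltn_ord i); have [_ _ uv] := uvA i j (ltn_ord i) (ltn_ord j).
  by rewrite bJ vK bformZl uv mulr0 mxE.
- by have [-> _ _] := uvA i j (ltn_ord i) (ltn_ord j); rewrite !mxE.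
- by have [_ _ ->] := uvA i j (ltn_ord i) (ltn_ord j); rewrite !mxE.
- by have [_ _ uv] := uvA j i (ltn_ord j) (ltn_ord i); rewrite bA uv !mxE.
- by have [_ -> _] := uvA i j (ltn_ord i) (ltn_ord j); rewrite !mxE.
Qed.

(** Permuting both halves of the basis by the same permutation is symplectic, so the eigenvalues can
    be sorted. *)
Lemma is_sympl_eigs_exists (R : rcfType) (n : nat) (A : 'M[R]_(n + n)) :
  posdef_mx A -> exists d, is_sympl_eigs A d.
Proof.
move=> /williamson_exists[d [d0 [S [JS AS]]]].
have [s sd] := incr_entries_perm d.
exists (\row_i (incr_entries d)`_i); split; last first.
  by move=> i j ij; rewrite !mxE; exact: incr_entries_sorted.
split=> [i|]; first by rewrite mxE sd.
pose P : 'M[R]_n := (perm_mx s)^T; pose Q := block_mx P 0 0 P.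
have PP : P^T *m P = 1%:M by rewrite /P trmxK tr_perm_mx -perm_mxM mulgV perm_mx1.
have QJ : Q^T *m Jmx R n *m Q = Jmx R n.
  rewrite /Q /Jmx tr_block_mx !mulmx_block !trmx0.
  rewrite !(mul0mx, mulmx0, mulmx1, mul1mx, add0r, addr0).
  by rewrite !(mulmxN, mulNmx) mulmx1 PP.
have PD : P^T *m diag_mx d *m P = diag_mx (\row_i (incr_entries d)`_i).
  rewrite trmxK /P tr_perm_mx -row_permE -col_permE.
  by apply/matrixP => i j; rewrite !mxE sd (inj_eq perm_inj).
exists (S *m Q); split.
  by rewrite /symplectic trmx_mul !mulmxA -(mulmxA _ S^T) -(mulmxA Q^T) JS QJ.
rewrite trmx_mul !mulmxA -(mulmxA _ S^T) -(mulmxA Q^T) AS /dbldiag /Q tr_block_mx !mulmx_block.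
by rewrite !trmx0 !(mul0mx, mulmx0, add0r, addr0) PD.
Qed.

(** * Symplectic matrices and the trace inequality *)

Section SymplecticGroup.
Variables (R : rcfType) (n : nat).
Local Notation J := (Jmx R n).
Implicit Types (S T : 'M[R]_(n + n)) (d : 'rV[R]_n).

Lemma symplectic_mul S T : symplectic S -> symplectic T -> symplectic (S *m T).
Proof.
by rewrite /symplectic => JS JT; rewrite trmx_mul !mulmxA -(mulmxA _ S^T) -(mulmxA T^T) JS JT.
Qed.

Lemma symplectic_mulVmx S : symplectic S -> - J *m S^T *m J *m S = 1%:M.
Proof.
by move=> JS; rewrite -!mulmxA mulNmx [S^T *m _]mulmxA JS JmxM opprK.
Qed.

Lemma symplectic_inv S : symplectic S ->
  exists T, [/\ symplectic T, T *m S = 1%:M & S *m T = 1%:M].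
Proof.
move=> JS; have TS := symplectic_mulVmx JS.
have ST := mulmx1C TS; exists (- J *m S^T *m J); split=> //.
move: (_ *m J) ST => T ST.
have : (S *m T)^T *m J *m (S *m T) = J by rewrite ST trmx1 mul1mx mulmx1.
by rewrite trmx_mul !mulmxA -(mulmxA _ S^T) -(mulmxA T^T) JS.
Qed.

(** The left inverse [- J *m S^T *m J] of [S] is also a right inverse; multiplying by [J] on the
    right cancels its last factor. *)
Lemma symplectic_tr S : symplectic S -> S *m J *m S^T = J.
Proof.
move=> JS; have TS := symplectic_mulVmx JS.
have := congr1 (mulmx^~ J) (mulmx1C TS).
by rewrite mul1mx !mulNmx !mulmxN mulNmx !mulmxA -[_ *m J *m J]mulmxA JmxM mulmxN mulmx1 opprK.
Qed.

Lemma dbldiag_diag d : dbldiag d = diag_mx (row_mx d d).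
Proof. by rewrite diag_mx_row. Qed.

Lemma dbldiag_commJ d : dbldiag d *m J = J *m dbldiag d.
Proof.
rewrite /dbldiag /Jmx !mulmx_block.
by rewrite !(mul0mx, mulmx0, mulmx1, mul1mx, addr0, add0r, mulmxN, mulNmx).
Qed.

Lemma trace_dbldiag d : \tr (dbldiag d) = 2 * \sum_i d 0 i.
Proof. by rewrite mxtrace_block mxtrace_diag -mulr2n mulr_natl. Qed.

(** For positive weights the right-hand side is nonnegative and vanishes only at [E = 0], which is
    how the equality case is detected. *)
Lemma trace_sandwich_diag m (c : 'rV[R]_m) (E : 'M[R]_m) :
  \tr (E^T *m diag_mx c *m E) = \sum_i \sum_j c 0 i * E i j ^+ 2.
Proof.
rewrite -mulmxA mxtrace_mulC; apply: eq_bigr => i _.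
rewrite mul_diag_mx !mxE; apply: eq_bigr => j _.
by rewrite !mxE -mulrA -expr2.
Qed.

(* [T + J T J] vanishes exactly when [T] commutes with [J]. *)
Lemma trace_defect T d : symplectic T ->
  let E := T + J *m T *m J in
  \tr (E^T *m dbldiag d *m E) = 2 * \tr (T^T *m dbldiag d *m T) - 4 * \sum_i d 0 i.
Proof.
move=> JT E; set D := dbldiag d.
have DT : D^T = D by rewrite /D dbldiag_diag tr_diag_mx.
(* By cyclicity of the trace, [T *m J *m T^T = J] removes [T] from the cross term and leaves
   [\tr (D *m J *m J)]. *)
have cross : \tr (T^T *m D *m (J *m T *m J)) = - (2 * \sum_i d 0 i).
  rewrite -mulmxA mxtrace_mulC -!mulmxA (mulmxA T J) symplectic_tr // JmxM.
  by rewrite mulmxN mulmx1 linearN /= /D trace_dbldiag.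
have cross' : \tr ((J *m T *m J)^T *m D *m T) = - (2 * \sum_i d 0 i).
  by rewrite -cross -mxtrace_tr !trmx_mul !trmxK DT !mulmxA.
have quad : \tr ((J *m T *m J)^T *m D *m (J *m T *m J)) = \tr (T^T *m D *m T).
  have JDJ : J^T *m D *m J = D.
    by rewrite Jmx_tr -mulmxA dbldiag_commJ mulmxA mulNmx JmxM opprK mul1mx.
  have JJt : J *m J^T = 1%:M by rewrite Jmx_tr mulmxN JmxM opprK.
  rewrite mulmxA mxtrace_mulC !trmx_mul !mulmxA JJt mul1mx.
  by rewrite -(mulmxA T^T J^T) -(mulmxA T^T _ J) JDJ.
rewrite /E [(T + _)^T]linearD !mulmxDl !mulmxDr !mxtraceD cross cross' quad; ring.
Qed.

Lemma commJ_orthogonal S : symplectic S -> S *m J = J *m S -> orthogonal_mx S.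
Proof.
rewrite /symplectic /orthogonal_mx => JS cJ.
have E : S^T *m S *m J = J by rewrite -mulmxA cJ mulmxA JS.
have := congr1 (mulmx^~ (- J)) E.
by rewrite !mulmxN -(mulmxA _ J J) JmxM mulmxN mulmx1 !opprK.
Qed.

(** The gap [2 * \tr A - 4 * \sum_i d 0 i] is a positively weighted sum of squares of the entries of
    [E]. If it is not positive, then [E = 0], so the inverse [T] of [S], and with it [S], commutes
    with [J]. *)
Lemma williamson_trace (A S : 'M[R]_(n + n)) d :
    (forall i, 0 < d 0 i) -> symplectic S -> S^T *m A *m S = dbldiag d ->
  2 * \sum_i d 0 i <= \tr A /\ (\tr A <= 2 * \sum_i d 0 i -> orthosymplectic S).
Proof.
move=> d0 JS AS; have [T [JT TS ST]] := symplectic_inv JS.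
have AT : T^T *m dbldiag d *m T = A.
  by rewrite -AS !mulmxA -trmx_mul ST trmx1 mul1mx -mulmxA ST mulmx1.
have := trace_defect d JT; rewrite /= AT dbldiag_diag trace_sandwich_diag.
set E := T + _ => defect.
have c0 i : 0 < row_mx d d 0 i by case: (split_ordP i) => j ->; rewrite ?row_mxEl ?row_mxEr d0.
have E0 i j : 0 <= row_mx d d 0 i * E i j ^+ 2 by rewrite mulr_ge0 ?sqr_ge0 ?ltW.
split=> [|le].
  suff : 0 <= 2 * \tr A - 4 * \sum_i d 0 i by lra.
  by rewrite -defect; apply: sumr_ge0 => i _; apply: sumr_ge0.
have Ez : E = 0.
  have : \sum_i \sum_j row_mx d d 0 i * E i j ^+ 2 == 0.
    rewrite eq_le; apply/andP; split; first by rewrite defect; lra.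
    by apply: sumr_ge0 => i _; apply: sumr_ge0.
  rewrite psumr_eq0 => [/allP z|i _]; last exact: sumr_ge0.
  apply/matrixP => i j; move/(_ i): z; rewrite mem_index_enum => /(_ isT) /=.
  rewrite psumr_eq0 => [/allP/(_ j)|k _ //]; rewrite mem_index_enum => /(_ isT) /=.
  by rewrite mulf_eq0 sqrf_eq0 gt_eqF //= => /eqP ->; rewrite mxE.
have cT : T *m J = J *m T.
  have := congr1 (mulmx^~ J) Ez; rewrite mul0mx mulmxDl -[J *m T *m J *m J]mulmxA JmxM.
  by rewrite mulmxN mulmx1 => /eqP; rewrite subr_eq0 => /eqP.
split=> //; apply: commJ_orthogonal => //.
by rewrite -[LHS]mulmx1 -TS mulmxA -(mulmxA S J T) -cT mulmxA ST mul1mx.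
Qed.
End SymplecticGroup.

(** * Majorization and orthosymplectic conjugation *)

Lemma sum_incr_entries (R : rcfType) (n : nat) (x : 'rV[R]_n) :
  \sum_(i < n) (incr_entries x)`_i = \sum_i x 0 i.
Proof.
have [s sx] := incr_entries_perm x.
by under eq_bigr do rewrite sx; rewrite [RHS](reindex_inj (@perm_inj _ s)).
Qed.

(** A partial sum of the sorted [x] is a sum of sorted entries of [y] with weights [c j] between 0
    and 1 of total [k]; it is least when the weight sits on the [k] smallest entries, the choice
    encoded by [b]. *)
Lemma doubly_stochastic_majorized (R : rcfType) (n : nat) (P : 'M[R]_n) (x y : 'rV[R]_n) :
    (forall i j, 0 <= P i j) -> (forall i, \sum_j P i j = 1) ->
    (forall j, \sum_i P i j = 1) -> (forall i, x 0 i = \sum_j P i j * y 0 j) ->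
  majorized x y.
Proof.
move=> P0 Pr Pc xE; split=> [k /andP[k0 kn]|]; last first.
  rewrite !sum_incr_entries; under eq_bigr do rewrite xE; rewrite exchange_big /=.
  by apply: eq_bigr => j _; rewrite -mulr_suml Pc mul1r.
have [s sx] := incr_entries_perm x; have [t ty] := incr_entries_perm y.
pose c (j : 'I_n) := \sum_(i < n | (i < k)%N) P (s i) (t j).
have c0 j : 0 <= c j by apply: sumr_ge0.
have c1 j : c j <= 1.
  rewrite -(Pc (t j)) (reindex_inj (@perm_inj _ s)) /=.
  rewrite [leRHS](bigID (fun i : 'I_n => (i < k)%N)) /=.
  by rewrite lerDl sumr_ge0.
(* Indices start at 0, so [theta] is the [k]-th smallest entry of [y]. Both [c j - b j] and the
   [j]-th sorted entry minus [theta] are nonpositive for [j < k] and nonnegative afterwards. *)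
pose theta := (incr_entries y)`_k.-1.
pose b (j : 'I_n) : R := ((j < k)%N)%:R.
have sumE (F : nat -> R) : \sum_(i < k) F i = \sum_(i < n) b i * F i.
  rewrite (big_ord_widen n F kn) big_mkcond /=; apply: eq_bigr => i _.
  by rewrite /b; case: ifP; rewrite ?mul1r ?mul0r.
have sumx : \sum_(i < k) (incr_entries x)`_i = \sum_(j < n) c j * (incr_entries y)`_j.
  rewrite (big_ord_widen n (nth 0 (incr_entries x)) kn).
  under [RHS]eq_bigr do rewrite mulr_suml; rewrite [RHS]exchange_big /=.
  apply: eq_bigr => i _; rewrite sx xE (reindex_inj (@perm_inj _ t)) /=.
  by apply: eq_bigr => j _; rewrite ty.
have sumc : \sum_(j < n) (c j - b j) = 0.
  rewrite big_split sumrN /= exchange_big /=.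
  have Pt i : \sum_j P (s i) (t j) = 1.
    by rewrite -(Pr (s i)) [RHS](reindex_inj (@perm_inj _ t)).
  under eq_bigr do rewrite Pt.
  by apply/eqP; rewrite subr_eq0 big_mkcond /=; apply/eqP/eq_bigr => i _; rewrite /b; case: ifP.
rewrite sumx sumE -subr_ge0 -sumrB.
(* The differences [c j - b j] sum to 0, so subtracting [theta] leaves the sum unchanged and makes
   every term nonnegative. *)
suff -> : \sum_(j < n) (c j * (incr_entries y)`_j - b j * (incr_entries y)`_j) =
    \sum_(j < n) (c j - b j) * ((incr_entries y)`_j - theta).
  apply: sumr_ge0 => j _; rewrite /b /theta.
  have kn' : (k.-1 < n)%N by rewrite prednK.
  case: ltnP => jk.
    rewrite -mulrNN mulr_ge0 // oppr_ge0 subr_le0 //.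
    by apply: (@incr_entries_sorted _ _ y j (Ordinal kn')); rewrite /= -ltnS prednK.
  rewrite subr0 mulr_ge0 // subr_ge0.
  apply: (@incr_entries_sorted _ _ y (Ordinal kn') j).
  by rewrite /= (leq_trans (leq_pred k)).
under [RHS]eq_bigr do rewrite mulrBr; rewrite [RHS]sumrB -mulr_suml sumc mul0r subr0.
by apply: eq_bigr => j _; rewrite mulrBl.
Qed.

(** Orthogonality turns the symplectic relation into commutation with [Jmx R n], which forces the
    block shape; the two identities are the upper left blocks of [S *m S^T] and [S^T *m S]. *)
Lemma orthosymplectic_blocks (R : rcfType) (n : nat) (S : 'M[R]_(n + n)) :
  orthosymplectic S -> exists X Y : 'M[R]_n, [/\ S = block_mx X Y (- Y) X,
    X *m X^T + Y *m Y^T = 1%:M & X^T *m X + Y^T *m Y = 1%:M].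
Proof.
move=> [JS oS]; have oS' := mulmx1C oS.
have SJ : S *m Jmx R n = Jmx R n *m S.
  by rewrite -[RHS]mul1mx -oS' -!mulmxA [S^T *m _]mulmxA JS.
move: JS oS oS' SJ; rewrite -[S]submxK.
set X := ulsubmx S; set Y := ursubmx S; set Z := dlsubmx S; set W := drsubmx S.
rewrite /orthogonal_mx /Jmx tr_block_mx !mulmx_block.
rewrite !(mul0mx, mulmx0, mulmx1, mul1mx, addr0, add0r, mulmxN, mulNmx).
move=> _ oS oS' /eq_block_mx[NY XW _ _]; exists X, Y; split; first by rewrite NY XW.
  by move: oS'; rewrite scalar_mx_block => /eq_block_mx[].
move: oS; rewrite scalar_mx_block => /eq_block_mx[<- _ _ _].
by rewrite -NY [(- Y)^T]linearN /= mulmxN mulNmx opprK.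
Qed.

Lemma orthosympl_diag_majorized (R : rcfType) (n : nat) (A S : 'M[R]_(n + n)) (d : 'rV[R]_n) :
    (forall i, 0 < d 0 i) -> orthosymplectic S -> S^T *m A *m S = dbldiag d ->
  [/\ majorized (Delta_w A) d, majorized (Delta_h A) d & \tr A = 2 * \sum_i d 0 i].
Proof.
move=> d0 oS AS; have [X [Y [SE rXY cXY]]] := orthosymplectic_blocks oS.
have SSt : S *m S^T = 1%:M by apply: mulmx1C; case: oS.
have trA : \tr A = 2 * \sum_i d 0 i.
  by rewrite -trace_dbldiag -AS -mulmxA mxtrace_mulC -mulmxA SSt mulmx1.
have AE : A = S *m dbldiag d *m S^T.
  by rewrite -AS !mulmxA SSt mul1mx -mulmxA SSt mulmx1.
(* [P i j] is the squared modulus of an entry of the unitary matrix [X + i Y], hence [P] is doubly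
   stochastic. *)
pose P : 'M[R]_n := \matrix_(i, j) (X i j ^+ 2 + Y i j ^+ 2).
have P0 i j : 0 <= P i j by rewrite mxE addr_ge0 ?sqr_ge0.
have Pr i : \sum_j P i j = 1.
  have := congr1 (fun M : 'M_n => M i i) rXY; rewrite !mxE eqxx mulr1n -big_split /= => <-.
  by apply: eq_bigr => j _; rewrite !mxE !expr2.
have Pc j : \sum_i P i j = 1.
  have := congr1 (fun M : 'M_n => M j j) cXY; rewrite !mxE eqxx mulr1n -big_split /= => <-.
  by apply: eq_bigr => i _; rewrite !mxE !expr2.
pose a : 'rV[R]_n := \row_i \sum_j P i j * d 0 j.
have a0 i : 0 <= a 0 i by rewrite mxE sumr_ge0 // => j _; rewrite mulr_ge0 // ltW.
have maj : majorized a d by apply: (doubly_stochastic_majorized P0 Pr Pc) => i; rewrite mxE.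
have quad (M N : 'M[R]_n) i : (M *m diag_mx d *m N^T) i i = \sum_j M i j * d 0 j * N i j.
  by rewrite mul_mx_diag !mxE; apply: eq_bigr => j _; rewrite !mxE.
move: AE; rewrite SE /dbldiag tr_block_mx !mulmx_block !(mulmx0, addr0, add0r) => AE.
have ul i : ulsubmx A i i = a 0 i.
  rewrite AE block_mxKul mxE !quad mxE -big_split /=.
  by apply: eq_bigr => j _; rewrite !mxE; ring.
have dr i : drsubmx A i i = a 0 i.
  rewrite AE block_mxKdr mxE !quad mxE -big_split /=.
  by apply: eq_bigr => j _; rewrite !mxE; ring.
(* With [D = diag_mx d], this block is [Y D X^T - X D Y^T], which is antisymmetric. *)
have ur i : ursubmx A i i = 0.
  rewrite AE block_mxKur mxE !quad -big_split /=.
  by apply: big1 => j _; rewrite !mxE; ring.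
have wE : Delta_w A = a.
  by apply/rowP => i; rewrite mxE ul dr -[RHS](ger0_norm (a0 i)) -sqrtr_sqr; congr Num.sqrt; field.
have hE : Delta_h A = a.
  apply/rowP => i; rewrite mxE ul dr ur -[RHS](ger0_norm (a0 i)) -sqrtr_sqr.
  by congr Num.sqrt; field.
by rewrite wE hE.
Qed.

(** * Trace bounds and the equivalences *)

(** The quadratic mean dominates the arithmetic mean: the squares differ by
    [((a - b) / 2) ^+ 2 + c / 2], where [c] is 0 for [Delta_w] and twice the squared diagonal entry
    of [ursubmx A] for [Delta_h]. *)
Lemma trace_le_Delta (R : rcfType) (n : nat) (A : 'M[R]_(n + n)) :
  \tr A <= 2 * \sum_i Delta_w A 0 i /\ \tr A <= 2 * \sum_i Delta_h A 0 i.
Proof.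
have half (a b c : R) : 0 <= c -> (a + b) / 2 <= Num.sqrt ((a ^+ 2 + b ^+ 2 + c) / 2).
  move=> c0; apply: le_trans (ler_norm _) _; rewrite -sqrtr_sqr ler_wsqrtr //.
  rewrite -subr_ge0 [X in 0 <= X](_ : _ = ((a - b) / 2) ^+ 2 + c / 2); last by field.
  by rewrite addr_ge0 ?sqr_ge0 ?divr_ge0.
have -> : \tr A = 2 * \sum_i ((ulsubmx A i i + drsubmx A i i) / 2).
  rewrite -[A in LHS]submxK mxtrace_block -mulr_suml mulrCA divff ?mulr1 ?pnatr_eq0 //.
  by rewrite -big_split.
split; rewrite ler_pM2l ?ltr0n // ler_sum // => i _.
  by rewrite [leRHS]mxE; have := half (ulsubmx A i i) (drsubmx A i i) 0 (lexx 0); rewrite addr0.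
by rewrite [leRHS]mxE half // mulr_ge0 ?sqr_ge0.
Qed.

Theorem theorem1p2 (R : rcfType) (n : nat) (hn : (0 < n)%N)
  (A : 'M[R]_(n + n)) (hA : posdef_mx A) :
  (majorized (Delta_w A) (sympl_eigs A) <-> majorized (Delta_h A) (sympl_eigs A)) /\
  (majorized (Delta_h A) (sympl_eigs A) <-> orthosympl_diagonalizable A).
Proof.
(* [xget] falls back on 0 when no vector qualifies; existence rules this out. *)
have : is_sympl_eigs A (sympl_eigs A).
  by have [d Ad] := is_sympl_eigs_exists hA; exact: (classical_sets.xgetPex 0 (ex_intro _ d Ad)).
set d := sympl_eigs A => -[[d0 [S [JS AS]]] _].
have [_ oS] := williamson_trace d0 JS AS.
have sumE x : majorized x d -> \sum_i x 0 i = \sum_i d 0 i.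
  by case=> _; rewrite !sum_incr_entries.
have [trw trh] := trace_le_Delta A.
have diag : \tr A <= 2 * \sum_i d 0 i -> orthosympl_diagonalizable A.
  by move=> /oS oS'; exists d; split=> //; exists S.
have diagV : orthosympl_diagonalizable A ->
    majorized (Delta_w A) d /\ majorized (Delta_h A) d.
  move=> [d' [d'0 [S' [oS' AS']]]].
  (* The trace of [A] is twice the sum of [d'], and [T *m S'] is a symplectic congruence from
     [dbldiag d] to [dbldiag d']. The trace inequality for [dbldiag d] bounds the sum of [d'] by
     that of [d], so [S] itself is orthosymplectic. *)
  suff /oS oS'' : \tr A <= 2 * \sum_i d 0 i.
    by have [] := orthosympl_diag_majorized d0 oS'' AS.
  have [_ _ ->] := orthosympl_diag_majorized d'0 oS' AS'; rewrite -(trace_dbldiag d).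
  have [T [JT TS ST]] := symplectic_inv JS.
  apply: (williamson_trace d'0 (symplectic_mul JT (proj1 oS')) _).1.
  rewrite -AS trmx_mul -AS' !mulmxA -(mulmxA _ T^T) -trmx_mul ST trmx1 mulmx1.
  by rewrite -(mulmxA _ S T) ST mulmx1.
have w_diag : majorized (Delta_w A) d -> orthosympl_diagonalizable A.
  by move=> /sumE wE; apply: diag; rewrite -wE.
have h_diag : majorized (Delta_h A) d -> orthosympl_diagonalizable A.
  by move=> /sumE hE; apply: diag; rewrite -hE.
split; split; first by move=> /w_diag/diagV[].
- by move=> /h_diag/diagV[].
- exact: h_diag.
- by move=> /diagV[].
Qed.
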